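(* Let $G$ be a graph and let $v$ be a vertex of $G$. Then $$\sigma_1(G)=\sigma_1(G-v)+\sigma_1(G-N[v])+\sum_{u\in N(v)}\sigma_0\bigl(G-(N[u]\cup N[v])\bigr)\ge\sigma_1(G-v).$$
   Context: Graphs are finite, simple and undirected. For a graph $G$ and $k\in\{0,1\}$, $\sigma_k(G)$ denotes the number of subsets $I$ of the vertex set $V(G)$ such that the subgraph of $G$ induced by $I$ has exactly $k$ edges; in particular, for the graph with no vertices, $\sigma_0=1$ and $\sigma_1=0$. $N(v)$ is the set of neighbours of $v$ in $G$ and $N[v]=N(v)\cup\{v\}$. For $S\subseteq V(G)$, $G-S$ is the graph obtained from $G$ by deleting the vertices of $S$ and all edges incident to them, and $G-v=G-\{v\}$. *)

(* Defs.v *)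
From mathcomp Require Import all_boot.

Set Implicit Arguments.
Unset Strict Implicit.
Unset Printing Implicit Defensive.

Record sgraph : Type := SGraph {
  vertex :> finType;
  adj : rel vertex;
  adj_sym : symmetric adj;
  adj_irrefl : irreflexive adj
}.

(* Edges are unordered: each one is the 2-element set of its endpoints. *)
Definition edges (G : sgraph) : {set {set G}} :=
  [set e : {set G} | [exists x, exists y, adj x y && (e == [set x; y])]].

Section Operations.
Variable G : sgraph.

Definition open_nbhd (v : G) : {set G} := [set u | adj v u].

Definition closed_nbhd (v : G) : {set G} := v |: open_nbhd v.

Section Induced.
Variable A : {set G}.

Definition induced_adj : rel {x : G | x \in A} :=
  fun x y => adj (val x) (val y).

Lemma induced_adj_sym : symmetric induced_adj.
Proof. by move=> x y; apply: adj_sym. Qed.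

Lemma induced_adj_irrefl : irreflexive induced_adj.
Proof. by move=> x; apply: adj_irrefl. Qed.

Definition induced : sgraph := SGraph induced_adj_sym induced_adj_irrefl.
End Induced.

Definition delete (S : {set G}) : sgraph := induced (~: S).

Definition delete_vertex (v : G) : sgraph := delete [set v].
End Operations.

Definition sigma (k : nat) (G : sgraph) : nat :=
  #|[set I : {set G} | #|edges (induced I)| == k]|.

(* Main.v *)
(** Everything reduces to counting subsets of [V(G)].  If [x \notin J], adding
    [x] to [J] creates exactly [#|N(x) :&: J|] new edges.  A set containing [v]
    therefore induces one edge iff, after removing [v], either one edge is left
    and no neighbour of [v], or no edge and exactly one neighbour [u].  In the
    second case removing [u] as well leaves an edgeless set that avoids
    [N[u]] and [N[v]]. *)
Require Import Defs.
From mathcomp Require Import all_boot.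

Set Implicit Arguments.
Unset Strict Implicit.
Unset Printing Implicit Defensive.

Section SetCounting.
Variable T : finType.
Implicit Types (A D : {set T}) (x : T).

(** The map [J |-> x |: J] is a bijection from the sets avoiding [x] to those containing it, with
    inverse [I |-> I :\ x]. This serves to remove first [v] and then [u]. *)
Lemma card_sets_with x (P : pred {set T}) :
  #|[set I : {set T} | (x \in I) && P I]| =
  #|[set J : {set T} | (x \notin J) && P (x |: J)]|.
Proof.
rewrite -[RHS](@card_in_imset _ _ (fun J => x |: J)).
  congr #|pred_of_set _|; apply/setP=> I; rewrite inE.
  apply/andP/imsetP=> [[Ix PI]|[J + ->]].
    by exists (I :\ x); rewrite ?inE ?eqxx setD1K.
  by rewrite inE setU11 => /andP[].
move=> I J; rewrite !inE => /andP[xI _] /andP[xJ _] /(congr1 (fun K => K :\ x)).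
by rewrite !setU1K.
Qed.

Lemma card_sets_split (P Q : pred {set T}) :
  #|[set I | P I]| = #|[set I | Q I && P I]| + #|[set I | ~~ Q I && P I]|.
Proof.
rewrite -(cardsID [set I | Q I]); congr (_ + _); apply: eq_card => I.
  by rewrite !inE andbC.
by rewrite !inE.
Qed.

(** Distinct [u] give distinct singletons, so at most one summand is 1. *)
Lemma card_eq1_sum A D : D \subset A ->
  (#|D| == 1 :> nat) = \sum_(u in A) (D == [set u]) :> nat.
Proof.
move=> sDA; case: (boolP (#|D| == 1)) => [/cards1P[u DE]|n1].
  have Au : u \in A by rewrite (subsetP sDA) // DE set11.
  rewrite (bigD1 u) //= DE eqxx big1 // => w /andP[_ wu].
  by rewrite (inj_eq set1_inj) eq_sym (negbTE wu).
rewrite big1 // => u _; case: eqP => // DE.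
by rewrite DE cards1 in n1.
Qed.

(** Sorts the sets [J] by the single element of [A :&: J]: a double count of the pairs [(J, u)]. *)
Lemma card_sets_meet1 (P : pred {set T}) A :
  #|[set J : {set T} | P J && (#|A :&: J| == 1)]| =
  \sum_(u in A) #|[set J : {set T} | P J && (A :&: J == [set u])]|.
Proof.
have cardE (Q : pred {set T}) : #|[set J | P J && Q J]| = \sum_(J | P J) Q J.
  by rewrite -sum1dep_card big_mkcondr; apply: eq_bigr => J _; case: (Q J).
rewrite cardE (eq_bigr _ (fun u _ => cardE _)) exchange_big /=.
by apply: eq_bigr => J _; rewrite (@card_eq1_sum A) ?subsetIl.
Qed.

End SetCounting.

(** Keeps the edges of an induced subgraph as sets over [G] itself, so that different vertex sets
    can be compared without changing type. *)
Definition edges_in (G : sgraph) (I : {set G}) : {set {set G}} :=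
  [set e in edges G | e \subset I].

Lemma in_edges_in (G : sgraph) (I e : {set G}) :
  (e \in edges_in I) = (e \in edges G) && (e \subset I).
Proof. by rewrite in_set. Qed.

Lemma edgeP (G : sgraph) (e : {set G}) :
  reflect (exists x y, adj x y /\ e = [set x; y]) (e \in edges G).
Proof.
rewrite inE; apply: (iffP existsP) => [[x /existsP[y /andP[xy /eqP->]]]|].
  by exists x, y.
by case=> x [y [xy ->]]; exists x; apply/existsP; exists y; rewrite xy eqxx.
Qed.

Lemma adj_neq (G : sgraph) (x y : G) : adj x y -> x != y.
Proof. by apply: contraTneq => ->; rewrite adj_irrefl. Qed.

Lemma edges_in_induced (G : sgraph) (A : {set G}) (J : {set induced A}) :
  [set val @: e | e : {set induced A} in edges_in J] =
  edges_in (val @: J : {set G}).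
Proof.
apply/setP=> e; apply/imsetP/idP=> [[e' + ->]|].
  rewrite !in_edges_in => /andP[/edgeP[x [y [xy ->]]] sJ].
  apply/andP; split; last exact: imsetS.
  by apply/edgeP; exists (val x), (val y); rewrite imsetU1 imset_set1.
rewrite in_edges_in => /andP[/edgeP[x [y [xy ->]]]].
rewrite subUset !sub1set => /andP[/imsetP[x' Jx xE] /imsetP[y' Jy yE]].
exists [set x'; y']; last by rewrite imsetU1 imset_set1 xE yE.
rewrite in_edges_in subUset !sub1set Jx Jy !andbT.
by apply/edgeP; exists x', y'; split=> //; rewrite /= /induced_adj -xE -yE.
Qed.

(** Transport along the injection [val], applied to the full vertex set of [induced A], whose image
    is [A]. *)
Lemma card_edges_induced (G : sgraph) (A : {set G}) :
  #|edges (induced A)| = #|edges_in A|.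
Proof.
have -> : edges (induced A) = edges_in [set: induced A].
  by apply/setP=> e; rewrite in_edges_in subsetT andbT.
rewrite -(card_imset _ (imset_inj val_inj)) edges_in_induced.
congr #|edges_in _|; apply/setP=> x; apply/imsetP/idP=> [[y _ ->]|Ax].
  exact: (valP y).
by exists (exist _ x Ax).
Qed.

Section EdgeCounting.
Variable G : sgraph.
Implicit Types (A I J : {set G}) (v x : G).

Lemma sigma_induced k A :
  sigma k (induced A) =
  #|[set I : {set G} | (I \subset A) && (#|edges_in I| == k)]|.
Proof.
rewrite /sigma -(card_imset _ (imset_inj val_inj)).
congr #|pred_of_set _|; apply/setP=> I; rewrite inE.
apply/imsetP/andP=> [[J + ->]|[sIA kI]].
  rewrite inE card_edges_induced => kJ; split.
    by apply/subsetP=> _ /imsetP[x _ ->]; apply: (valP x).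
  by rewrite -edges_in_induced (card_imset _ (imset_inj val_inj)).
have IE : I = val @: [set x : induced A | val x \in I].
  apply/setP=> x; apply/idP/imsetP=> [Ix|[y + ->]]; last by rewrite inE.
  by exists (exist _ x (subsetP sIA x Ix)); rewrite ?inE.
exists [set x : induced A | val x \in I] => //.
rewrite inE card_edges_induced -(card_imset _ (imset_inj val_inj)).
by rewrite edges_in_induced -IE.
Qed.

(** The new edges are the pairs [[set x; y]] with [y] a neighbour of [x] in [J]. They contain [x],
    so none is an old edge, and [y] is recovered from its pair. *)
Lemma card_edges_in_setU1 x J : x \notin J ->
  #|edges_in (x |: J)| = #|edges_in J| + #|open_nbhd x :&: J|.
Proof.
move=> xJ.
have -> : edges_in (x |: J) =
    edges_in J :|: [set [set x; y] | y in open_nbhd x :&: J].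
  apply/setP=> e; rewrite in_setU !in_edges_in.
  apply/andP/orP=> [[Ee]|[/andP[-> sJ]|/imsetP[y]]].
  - case/edgeP: (Ee) => a [b [ab eE]].
    rewrite Ee eE !subUset !sub1set !in_setU1.
    case: (eqVneq a x) => [ax|nax] /=; last first.
      case: (eqVneq b x) => [bx|nbx] /= H; last by left.
      right; apply/imsetP; exists a; last by rewrite bx setUC.
      by rewrite !inE -bx adj_sym ab; case/andP: H.
    rewrite -ax eq_sym (negbTE (adj_neq ab)) /= => Jb.
    by right; apply/imsetP; exists b => //; rewrite !inE ab.
  - by split=> //; apply: subset_trans sJ (subsetUr _ _).
  - case/setIP; rewrite [y \in _]in_set => xy Jy ->; split.
      by apply/edgeP; exists x, y.
    by rewrite subUset !sub1set !in_setU1 eqxx Jy orbT.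
rewrite cardsU [edges_in J :&: _]disjoint_setI0; last first.
  rewrite disjoint_subset; apply/subsetP=> e.
  rewrite in_edges_in => /andP[_ /subsetP sJ]; apply/imsetP=> -[y _ eE].
  by case/negP: xJ; apply: sJ; rewrite eE !inE eqxx.
rewrite cards0 subn0; congr (_ + _); apply: card_in_imset => y z.
(* Injectivity: [y] lies in [[set x; z]] and differs from [x], hence equals [z]. *)
rewrite !inE => /andP[/adj_neq xy _] _ /setP/(_ y).
by rewrite !inE eqxx orbT eq_sym (negbTE xy) => /esym/eqP.
Qed.

Lemma subset_delete_closed v J :
  (J \subset ~: closed_nbhd v) = (v \notin J) && (#|open_nbhd v :&: J| == 0).
Proof.
by rewrite subsetC subUset sub1set inE cards_eq0 setI_eq0 disjoints_subset.
Qed.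

End EdgeCounting.

Theorem mainTheorem7 (G : sgraph) (v : G) :
  sigma 1 G =
    sigma 1 (delete_vertex v) + sigma 1 (delete (closed_nbhd v))
    + \sum_(u in open_nbhd v) sigma 0 (delete (closed_nbhd u :|: closed_nbhd v))
  /\
  sigma 1 (delete_vertex v) + sigma 1 (delete (closed_nbhd v))
    + \sum_(u in open_nbhd v) sigma 0 (delete (closed_nbhd u :|: closed_nbhd v))
  >= sigma 1 (delete_vertex v).
Proof.
split; last by rewrite -addnA leq_addr.
have -> : sigma 1 G = #|[set I : {set G} | #|edges_in I| == 1]|.
  by apply: eq_card => I; rewrite !inE card_edges_induced.
(* The sets avoiding [v] give the first term. *)
rewrite (card_sets_split _ (fun I : {set G} => v \in I)) addnC -addnA.
congr (_ + _).
  rewrite sigma_induced; apply: eq_card => I.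
  by rewrite !inE subsetC sub1set inE.
rewrite card_sets_with.
rewrite (card_sets_split _ (fun J : {set G} => #|open_nbhd v :&: J| == 0)).
congr (_ + _).
  rewrite sigma_induced; apply: eq_card => J; rewrite !inE subset_delete_closed.
  case: (boolP (v \in J)) => [_|vJ] /=; first by rewrite andbF.
  by case: eqP => //= N0; rewrite card_edges_in_setU1 // N0 addn0.
pose P (J : {set G}) := (v \notin J) && (#|edges_in J| == 0).
(* Here [v] has a neighbour in [J]; a sum equal to 1 with its second summand nonzero is [0 + 1]. *)
transitivity #|[set J | P J && (#|open_nbhd v :&: J| == 1)]|.
  apply: eq_card => J; rewrite !inE /P.
  case: (boolP (v \in J)) => [_|vJ] /=; first by rewrite andbF.
  rewrite card_edges_in_setU1 //.
  by case: #|edges_in J| => [|[|?]]; case: #|open_nbhd v :&: J| => [|[|?]];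
    rewrite ?addSn ?addnS.
rewrite card_sets_meet1; apply: eq_bigr => u; rewrite inE => vu.
pose Q (J : {set G}) := P J && (open_nbhd v :&: J == [set u]).
(* [Q J] already forces [u \in J]; stating it lets [card_sets_with] remove [u]. *)
transitivity #|[set J : {set G} | (u \in J) && Q J]|.
  apply: eq_card => J; rewrite !inE /Q.
  case: (boolP (u \in J)) => //= uJ; apply/negP => /andP[_ /eqP/setP/(_ u)].
  by rewrite !inE (negbTE uJ) andbF eqxx.
rewrite card_sets_with sigma_induced; apply: eq_card => K.
rewrite !inE setCU subsetI !subset_delete_closed /Q /P.
case: (boolP (u \in K)) => //= uK.
rewrite card_edges_in_setU1 // addn_eq0 in_setU1 (negbTE (adj_neq vu)) /=.
(* As [u] is a neighbour of [v] outside [K], it is the only neighbour of [v] in [u |: K] exactly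
   when [K] contains none. *)
have -> : (open_nbhd v :&: (u |: K) == [set u]) = (#|open_nbhd v :&: K| == 0).
  have Nu : u \in open_nbhd v by rewrite inE.
  rewrite setIUr (setIidPr _) ?sub1set // cards_eq0.
  apply/eqP/eqP=> [E|->]; last by rewrite setU0.
  rewrite -(@setU1K _ u (open_nbhd v :&: K)) ?E ?setDv //.
  by rewrite !inE (negbTE uK) andbF.
by case: (v \in K); rewrite ?andbF //=; do 3!case: (#|_| == 0).
Qed.
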